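(* Let $X\subset\mathbb{R}$ with the Euclidean metric, and let $(X,T_1,\mu_1)$ and $(X,T_2,\mu_2)$ be two probability preserving systems which are both exponentially mixing for $BV$ against $L^\infty$. Let $(r_n)_n$ be a sequence of positive numbers and suppose there is a function $h:\mathbb{N}\to(0,\infty)$ with $h(n)\to\infty$ such that for all $n$ sufficiently large \[ \int \mu_1(B(y,r_n))\,d\mu_2(y) \ge \frac{(\log n)^2 h(n)}{n^2} \] and, for $i=1,2$, \[ \frac{\bigl(\int \mu_i(B(y,r_n))\,d\mu_i(y)\bigr)^{1/2}}{\int \mu_1(B(y,r_n))\,d\mu_2(y)} \le \frac{n}{(\log n)\,h(n)}. \] Then $(\mu_1\times\mu_2)\bigl(\limsup_n E_{n,r_n}^{T_1,T_2}\bigr)=1$.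
   Context: A measure preserving system $(X,T,\mu)$ with $X\subset\mathbb{R}$ is exponentially mixing for $BV$ against $L^\infty$ if there are $C,\theta>0$ such that for all $\psi$ of bounded variation and all $\varphi\in L^\infty(\mu)$ and all $n\ge 0$, $\bigl|\int\psi\cdot\varphi\circ T^n\,d\mu-\int\psi\,d\mu\int\varphi\,d\mu\bigr|\le C\|\psi\|_{BV}\|\varphi\|_{L^\infty}e^{-\theta n}$. For $n\in\mathbb{N}$ and $r>0$, $E_{n,r}^{T_1,T_2}:=\{(x,y)\in X\times X : |T_1^i x- T_2^j y|<r \text{ for some } 0\le i,j<n\}$; $E_{n,r_n}^{T_1,T_2}$ denotes this set with $r=r_n$. $B(y,r)$ is the open ball of radius $r$ about $y$. *)

(* Defs.v *)
From HB Require Import structures.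
From mathcomp Require Import all_boot all_order all_algebra.
From mathcomp Require Import all_classical all_reals all_analysis ess_sup_inf.
Set Implicit Arguments. Unset Strict Implicit. Unset Printing Implicit Defensive.
Import Order.TTheory GRing.Theory Num.Def Num.Theory.
Import numFieldNormedType.Exports.
Local Open Scope classical_set_scope.
Local Open Scope ring_scope.

Definition seq_variation (R : realType) (psi : R -> R) (s : seq R) : R :=
  \sum_(i < (size s).-1) `|psi (nth 0 s i.+1) - psi (nth 0 s i)|.

Definition total_var_on (R : realType) (X : set R) (psi : R -> R) : \bar R :=
  ereal_sup [set (seq_variation psi s)%:E | s in
     [set s : seq R | sorted <%R s /\ (forall x, x \in s -> X x)]].

Definition sup_norm_on (R : realType) (X : set R) (psi : R -> R) : \bar R :=
  ereal_sup [set `|psi x|%:E | x in X].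

Definition bv_norm (R : realType) (X : set R) (psi : R -> R) : \bar R :=
  (total_var_on X psi + sup_norm_on X psi)%E.

Definition linf_norm (R : realType) (mu : {measure set R -> \bar R})
  (phi : R -> R) : \bar R :=
  ess_sup mu (fun x => (`|phi x|)%:E).

Definition prob_preserving (R : realType) (X : set R) (T : R -> R)
  (mu : probability R R) : Prop :=
  [/\ measurable X, mu X = 1%E, (forall x, X x -> X (T x)),
      measurable_fun X T &
      (forall A : set R, measurable A -> mu (X `&` T @^-1` A) = mu A)].

Definition exp_mixing_BV_Linf (R : realType) (X : set R) (T : R -> R)
  (mu : probability R R) : Prop :=
  exists C theta : R, 0 < C /\ 0 < theta /\
    forall (psi phi : R -> R) (n : nat),
      measurable_fun X psi -> (bv_norm X psi < +oo)%E ->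
      measurable_fun X phi -> (linf_norm mu phi < +oo)%E ->
      (`| (\int[mu]_(x in X) (psi x * phi (iter n T x))%:E)
          - (\int[mu]_(x in X) (psi x)%:E) * (\int[mu]_(x in X) (phi x)%:E) |
        <= C%:E * bv_norm X psi * linf_norm mu phi
           * (expR (- theta * n%:R))%:E)%E.

Definition Eset (R : realType) (X : set R) (T1 T2 : R -> R) (n : nat) (r : R)
  : set (R * R) :=
  [set xy | X xy.1 /\ X xy.2 /\
     exists i j : nat, (i < n)%N /\ (j < n)%N /\
       `|iter i T1 xy.1 - iter j T2 xy.2| < r].

Definition limsup_set (U : Type) (E : nat -> set U) : set U :=
  \bigcap_(k in [set: nat]) \bigcup_(n in [set n : nat | (k <= n)%N]) E n.

(* Main.v *)
Require Import Defs.
From HB Require Import structures.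
From mathcomp Require Import all_boot all_order all_algebra.
From mathcomp Require Import all_classical all_reals all_analysis ess_sup_inf.
From mathcomp Require Import measurable_realfun lra ring zify.
Import Order.TTheory GRing.Theory Num.Def Num.Theory.
Import numFieldNormedType.Exports.
Set Implicit Arguments. Unset Strict Implicit. Unset Printing Implicit Defensive.
Local Open Scope classical_set_scope.
Local Open Scope ring_scope.

(** Second moment method. Let [S] count the pairs [(i, j)], [i, j < n], with
    [|T1^i x - T2^j y| < r], and let [M] be the integral of [mu1 (ball y r)]
    against [mu2]. The mean of [S] is [n^2 M], and
    [1_(S = 0) <= (S / (n^2 M) - 1)^2], so the measure of [S = 0] is at most
    [E(S^2) / (n^2 M)^2 - 1]. The correlation of the events for [(i, j)] and
    [(i', j')] is at most

      - [M^2 + o(1)] when [|i - i'|] and [|j - j'|] both exceed [k ~ 5 ln n / theta],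
        by mixing in [x] (indicators of balls are BV) and then in [y] (so is
        [y |-> mu1 (ball y r)]);
      - [2 sqrt(A_i) M + o(1)] when only one of them does, where [A_i] is the
        integral of [mu_i (ball y r)] against [mu_i]: splitting [ball y r] into
        two halves of diameter [< r] gives [mu_i (ball y r) <= 2 sqrt(A_i)];
      - [M] in general.

    Counting the quadruples of each kind, the measure of [S = 0] tends to 0 along
    [n], which forces the limsup set to have full measure. *)

(** * Functions of bounded variation and mixing *)

(* Difference of two nondecreasing maps: covers both [x |-> 1_(ball y r) x] and
   [y |-> mu (ball y r)], with BV norm at most 3. *)
Definition unit_bv (R : realType) (psi : R -> R) : Prop :=
  (forall x, 0 <= psi x <= 1) /\
  exists F G : R -> R,
    [/\ {homo F : x y / x <= y}, {homo G : x y / x <= y},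
        (forall x, 0 <= F x <= 1), (forall x, 0 <= G x <= 1) &
        psi = F \- G].

Lemma measurable_unit_bv (R : realType) (psi : R -> R) :
  unit_bv psi -> measurable_fun setT psi.
Proof.
move=> [_ [F [G [Fnd Gnd _ _ ->]]]].
by apply: measurable_funB; apply: nondecreasing_measurable.
Qed.

(** The sum telescopes, leaving a difference of two values of [F], both in [0, 1]. *)
Lemma sum_increments_le1 (R : realType) (F : R -> R) (s : seq R) :
  (forall x, 0 <= F x <= 1) ->
  \sum_(i < (size s).-1) (F (nth 0 s i.+1) - F (nth 0 s i)) <= 1.
Proof.
move=> F01; rewrite -(big_mkord xpredT (fun i => F (nth 0 s i.+1) - F (nth 0 s i))).
rewrite (telescope_sumr (fun i => F (nth 0 s i)))//.
have := F01 (nth 0 s (size s).-1); have := F01 (nth 0 s 0); lra.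
Qed.

(** Each increment of [psi] is bounded by the sum of the increments of [F] and [G], whose totals are
    at most 1 each; the supremum adds the third unit. *)
Lemma bv_norm_unit_bv (R : realType) (X : set R) (psi : R -> R) :
  unit_bv psi -> (bv_norm X psi <= 3%:E)%E.
Proof.
move=> [psi01 [F [G [Fnd Gnd F01 G01 psiE]]]].
have -> : 3%:E = (2%:E + 1%:E)%E :> \bar R by rewrite -EFinD; congr EFin; lra.
apply: leeD.
  apply: ge_ereal_sup => _ [s [sorted_s _] <-]; rewrite lee_fin /seq_variation.
  pose dF (i : 'I_(size s).-1) := F (nth 0 s i.+1) - F (nth 0 s i).
  pose dG (i : 'I_(size s).-1) := G (nth 0 s i.+1) - G (nth 0 s i).
  have le_dd : \sum_(i < (size s).-1) `|psi (nth 0 s i.+1) - psi (nth 0 s i)|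
      <= \sum_i dF i + \sum_i dG i.
    rewrite -big_split/=; apply: ler_sum => i _.
    have si : nth 0 s i <= nth 0 s i.+1.
      apply/ltW; have /sortedP-/(_ 0) := sorted_s; apply.
      by have := ltn_ord i; rewrite ltn_predRL.
    have := Fnd _ _ si; have := Gnd _ _ si.
    by rewrite ler_norml /dF /dG psiE/= => ? ?; apply/andP; split; lra.
  have := sum_increments_le1 s F01; have := sum_increments_le1 s G01.
  by move: le_dd; rewrite /dF /dG => ? ? ?; lra.
apply: ge_ereal_sup => _ [x _ <-]; rewrite lee_fin.
by have /andP[? ?] := psi01 x; rewrite ger0_norm.
Qed.

Lemma linf_norm_unit_le1 (R : realType) (mu : {measure set R -> \bar R})
    (phi : R -> R) :
  (forall x, 0 <= phi x <= 1) -> (linf_norm mu phi <= 1)%E.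
Proof.
move=> phi01; apply: ess_sup_ler => x; rewrite lee_fin.
by have /andP[? ?] := phi01 x; rewrite ger0_norm.
Qed.

(** Rests on the total mass being positive: for the zero measure the essential supremum would be
    minus infinity. *)
Lemma linf_norm_ge0 (R : realType) (mu : probability R R)
    (phi : R -> R) : (0 <= linf_norm mu phi)%E.
Proof.
apply: ess_sup_ger => [|x]; last by rewrite lee_fin.
by rewrite [ltRHS](_ : _ = 1%E) ?lte01//; exact: probability_setT.
Qed.

Lemma integral_full_set (R : realType) (X : set R) (mu : probability R R)
    (f : R -> \bar R) :
  measurable X -> mu X = 1%E -> measurable_fun setT f ->
  (forall x, 0 <= f x)%E ->
  (\int[mu]_(x in X) f x = \int[mu]_x f x)%E.
Proof.
move=> mX muX mf f0.
have mXC0 : mu (~` X) = 0%E by rewrite probability_setC// muX subee.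
rewrite [RHS](@ge0_negligible_integral _ _ _ mu setT (~` X))//.
- by rewrite setTD setCK.
- exact: measurableC.
Qed.

Lemma integral_prob_cst (R : realType) (d : measure_display)
    (T : measurableType d)
    (P : probability T R) (c : R) : (\int[P]_x c%:E = c%:E)%E.
Proof.
rewrite integral_cst// -[RHS]mule1; congr (_ * _)%E; exact: probability_setT.
Qed.

Lemma integral_prob_le (R : realType) (d : measure_display)
    (T : measurableType d)
    (P : probability T R) (f : T -> R) (c : R) :
  measurable_fun setT f -> (forall x, 0 <= f x <= c) ->
  (\int[P]_x (f x)%:E <= c%:E)%E.
Proof.
move=> mf f01; rewrite -(integral_prob_cst P c); apply: ge0_le_integral => //.
- by move=> x _; rewrite lee_fin; case/andP: (f01 x).
- exact/measurable_EFinP.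
- by move=> x _; rewrite lee_fin; case/andP: (f01 x).
Qed.

Lemma integral_unit_fin_num (R : realType) (d : measure_display)
    (T : measurableType d)
    (P : probability T R) (f : T -> R) :
  measurable_fun setT f -> (forall x, 0 <= f x <= 1) ->
  (\int[P]_x (f x)%:E)%E \is a fin_num.
Proof.
move=> mf f01; rewrite ge0_fin_numE.
  exact: le_lt_trans (integral_prob_le P mf f01) (ltry _).
by apply: integral_ge0 => x _; rewrite lee_fin; case/andP: (f01 x).
Qed.

(* [T] is only controlled on [X]; off [X], a null set, it is replaced by the
   identity so that all integrals can be taken over the whole line. *)
Definition extend_id (R : realType) (X : set R) (T : R -> R) : R -> R :=
  fun x => if x \in X then T x else x.

Lemma measurable_extend_id (R : realType) (X : set R) (T : R -> R) :
  measurable X -> measurable_fun X T -> measurable_fun setT (extend_id X T).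
Proof.
move=> mX mT; rewrite -(setUv X); apply/measurable_funU => //.
  exact: measurableC.
split.
  by apply: eq_measurable_fun mT => x xX; rewrite /extend_id xX.
apply: (eq_measurable_fun id); last exact: measurable_id.
move=> x; rewrite inE/= => xX; rewrite /extend_id.
by case: ifPn => //; rewrite inE.
Qed.

Lemma iter_extend_id (R : realType) (X : set R) (T : R -> R) (n : nat) (x : R) :
  (forall x, X x -> X (T x)) -> X x ->
  iter n (extend_id X T) x = iter n T x.
Proof.
move=> XT Xx; suff: iter n (extend_id X T) x = iter n T x /\ X (iter n T x) by case.
elim: n => //= n [-> Xn]; split; last exact: XT.
by rewrite /extend_id mem_set.
Qed.

(** Invariance on the whole line, without reference to X: this is the form available for
    [extend_id X T], and it iterates without domain conditions. *)
Definition preserves (R : realType) (T : R -> R) (mu : probability R R) : Prop :=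
  measurable_fun setT T /\
  forall A : set R, measurable A -> mu (T @^-1` A) = mu A.

(** The preimages of [A] under [T] and under its extension have the same trace on X, and what
    remains lies in the null complement of X. *)
Lemma preserves_extend_id (R : realType) (X : set R) (T : R -> R)
    (mu : probability R R) :
  prob_preserving X T mu -> preserves (extend_id X T) mu.
Proof.
move=> [mX muX XT mT Tmu]; split; first exact: measurable_extend_id.
move=> A mA; rewrite -[RHS](Tmu A mA).
have mXC0 : mu (~` X) = 0%E by rewrite probability_setC// muX subee.
have mTA : measurable (extend_id X T @^-1` A).
  by rewrite -[_ @^-1` _]setTI; apply: measurable_extend_id.
have -> : X `&` T @^-1` A = X `&` extend_id X T @^-1` A.
  by apply/seteqP; split => x [Xx] /=; rewrite /extend_id mem_set.
have mXC : measurable (~` X) by exact: measurableC.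
have mTAC0 : mu (extend_id X T @^-1` A `&` ~` X) = 0%E.
  apply/eqP; rewrite eq_le measure_ge0 andbT -mXC0.
  by apply: le_measure; rewrite ?inE//; exact: measurableI.
rewrite -[in LHS](setIT (extend_id X T @^-1` A)) -(setUv X) setIUr measureU//.
- by rewrite [RHS]/= setIC -[RHS]adde0; congr (_ + _)%E.
- exact: measurableI.
- exact: measurableI.
- by rewrite setIACA setICr setI0.
Qed.

Lemma measurable_iter (R : realType) (T : R -> R) (n : nat) :
  measurable_fun setT T -> measurable_fun setT (iter n T).
Proof.
by move=> mT; elim: n => [|n IHn]; [exact: measurable_id|exact: measurableT_comp mT IHn].
Qed.

Lemma preserves_integral_iter (R : realType) (T : R -> R) (mu : probability R R)
    (f : R -> \bar R) (n : nat) :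
  preserves T mu -> measurable_fun setT f -> (forall x, 0 <= f x)%E ->
  (\int[mu]_x f (iter n T x) = \int[mu]_x f x)%E.
Proof.
move=> [mT Tmu] mf f0; elim: n => [//|n IHn].
rewrite -IHn; have mfn : measurable_fun setT (fun x => f (iter n T x)).
  by apply: measurableT_comp => //; exact: measurable_iter.
(* The additional [T] is placed innermost, so the integrand is the previous one composed with [T],
   and the pushforward of [mu] by [T] is [mu]. *)
under eq_integral do rewrite iterSr.
rewrite -[RHS](@eq_measure_integral _ _ _ setT mu (pushforward mu T)).
  by rewrite (ge0_integral_pushforward mT).
by move=> A mA _; exact: Tmu.
Qed.

(** The one-sided form of mixing that the second moment consumes. The norms of the observables,
    bounded for [unit_bv], are absorbed into [K]. *)
Definition mixing_upper_bound (R : realType) (T : R -> R)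
    (mu : probability R R) (K theta : R) : Prop :=
  forall (psi phi : R -> R) (n : nat), unit_bv psi -> unit_bv phi ->
    (\int[mu]_x (psi x * phi (iter n T x))%:E <=
     \int[mu]_x (psi x)%:E * \int[mu]_x (phi x)%:E
       + (K * expR (- theta * n%:R))%:E)%E.

(** Iterates of [T] and of its extension agree on X, and the complement of X is null, so integrals
    over X and over the line coincide. The factor 3 in [K] bounds the BV norm of [psi]; the
    essential supremum of [phi] contributes at most 1. *)
Lemma mixing_upper_bound_extend_id (R : realType) (X : set R) (T : R -> R)
    (mu : probability R R) :
  prob_preserving X T mu -> exp_mixing_BV_Linf X T mu ->
  exists K theta : R, [/\ 0 < K, 0 < theta &
    mixing_upper_bound (extend_id X T) mu K theta].
Proof.
move=> pT [C [theta [C0 [theta0 mix]]]]; exists (C * 3), theta; split => //.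
  by rewrite mulr_gt0.
move=> psi phi n bpsi bphi.
have [mX muX XT mT Tmu] := pT.
have mpsi := measurable_unit_bv bpsi; have mphi := measurable_unit_bv bphi.
have [psi01 _] := bpsi; have [phi01 _] := bphi.
have psi0 x : 0 <= psi x by case/andP: (psi01 x).
have phi0 x : 0 <= phi x by case/andP: (phi01 x).
have mTn := measurable_iter n (measurable_extend_id mX mT).
have bvle := bv_norm_unit_bv X bpsi.
have lile := linf_norm_unit_le1 mu phi01.
have := mix psi phi n (measurable_funTS mpsi)
  (le_lt_trans bvle (ltry _)) (measurable_funTS mphi)
  (le_lt_trans lile (ltry _)).
have -> : (\int[mu]_(x in X) (psi x * phi (iter n T x))%:E =
           \int[mu]_x (psi x * phi (iter n (extend_id X T) x))%:E)%E.
  rewrite -(integral_full_set mX muX).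
  - apply: eq_integral => x /set_mem Xx.
    by rewrite iter_extend_id.
  - apply/measurable_EFinP; apply: measurable_funM => //.
    exact: measurableT_comp.
  - by move=> x; rewrite lee_fin mulr_ge0.
have -> : (\int[mu]_(x in X) (psi x)%:E = \int[mu]_x (psi x)%:E)%E.
  by apply: integral_full_set => //; exact/measurable_EFinP.
have -> : (\int[mu]_(x in X) (phi x)%:E = \int[mu]_x (phi x)%:E)%E.
  by apply: integral_full_set => //; exact/measurable_EFinP.
have bound : (C%:E * bv_norm X psi * linf_norm mu phi
    * (expR (- theta * n%:R))%:E <= (C * 3 * expR (- theta * n%:R))%:E)%E.
  rewrite EFinM; apply: lee_wpmul2r; first by rewrite lee_fin expR_ge0.
  (* Needed to multiply the two norm bounds. The empty list gives variation 0, and a point of X,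
     nonempty since it has mass 1, makes the supremum nonnegative. *)
  have bv0 : (0 <= bv_norm X psi)%E.
    apply: adde_ge0.
      apply: ereal_sup_ubound; exists [::] => //.
      by rewrite /seq_variation big_ord0.
    have [x Xx] : X !=set0.
      apply/set0P/eqP => X0; move: muX; rewrite X0 measure0 => /eqP.
      by rewrite eqe eq_sym oner_eq0.
    apply: (@le_trans _ _ (`|psi x|)%:E); first by rewrite lee_fin.
    by apply: ereal_sup_ubound; exists x.
  rewrite -[leRHS]mule1; apply: lee_pmul => //.
  - by apply: mule_ge0 => //; rewrite lee_fin ltW.
  - exact: linf_norm_ge0.
  - by rewrite EFinM; apply: lee_wpmul2l => //; rewrite lee_fin ltW.
set a := (\int[mu]_x (psi x * _)%:E)%E; set b := (_ * _)%E.
move=> /le_trans/(_ bound) abK.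
have bfin : b \is a fin_num.
  by apply: fin_numM; apply: integral_unit_fin_num.
rewrite -leeBlDl//; exact: le_trans (lee_abs _) abK.
Qed.

(** * Masses of balls *)

Definition close (R : realType) (r x y : R) : R := (`|x - y| < r)%R%:R.

Definition ball_mass (R : realType) (mu : probability R R) (r y : R) : R :=
  fine (mu (ball y r)).

Lemma close01 (R : realType) (r x y : R) : 0 <= close r x y <= 1.
Proof. by rewrite /close; case: (_ < _); rewrite ?lexx ?ler01. Qed.

Lemma closeC (R : realType) (r x y : R) : close r x y = close r y x.
Proof. by rewrite /close distrC. Qed.

Lemma closeE (R : realType) (r x y : R) : close r x y = \1_(ball y r) x.
Proof.
rewrite /close indicE; congr ((_ : bool)%:R); apply/idP/idP => [H|].
  by rewrite inE /ball/= distrC.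
by rewrite inE /ball/= distrC.
Qed.

(** The ball is an open interval, so its indicator is that of an open right half-line minus that of
    a closed one. *)
Lemma unit_bv_close (R : realType) (r y : R) :
  0 < r -> unit_bv (fun x => close r x y).
Proof.
move=> r0; split=> [x|]; first exact: close01.
exists (fun x => (y - r < x)%R%:R), (fun x => (y + r <= x)%R%:R); split.
- move=> a b ab; rewrite ler_nat.
  by case: ltP => // ya; rewrite (lt_le_trans ya ab).
- move=> a b ab; rewrite ler_nat.
  by case: leP => // ya; rewrite (le_trans ya ab).
- by move=> x; case: (y - r < x); rewrite ?lexx ?ler01.
- by move=> x; case: (y + r <= x); rewrite ?lexx ?ler01.
apply/funext => x; rewrite /close /= ltr_norml.
case: (ltP (y - r) x) => h1; case: (leP (y + r) x) => h2.
- by rewrite subrr; case: andP => // -[_ ?]; exfalso; lra.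
- by rewrite subr0; case: andP => // -[]; split; lra.
- exfalso; lra.
- by rewrite subrr; case: andP => // -[? _]; exfalso; lra.
Qed.

Lemma measurable_closeT (R : realType) (r : R) :
  measurable_fun setT (fun p : R * R => close r p.1 p.2).
Proof.
rewrite /close.
apply: (@measurableT_comp _ _ _ _ _ _ (fun b : bool => b%:R : R)) => //.
apply: measurable_fun_ltr => //; apply: measurableT_comp => //.
by apply: measurable_funB; [exact: measurable_fst|exact: measurable_snd].
Qed.

Lemma measurable_close (R : realType) (d : measure_display)
    (T : measurableType d) (r : R)
    (f g : T -> R) :
  measurable_fun setT f -> measurable_fun setT g ->
  measurable_fun setT (fun t => close r (f t) (g t)).
Proof.
move=> mf mg.
apply: (@measurableT_comp _ _ _ _ _ _ (fun p : R * R => close r p.1 p.2) _ (fun t => (f t, g t))).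
  exact: measurable_closeT.
exact: measurable_fun_pair.
Qed.

Lemma ball_mass_EFin (R : realType) (mu : probability R R) (r y : R) :
  ((ball_mass mu r y)%:E = mu (ball y r))%E.
Proof. by rewrite fineK// fin_num_measure//; exact: measurable_ball. Qed.

Lemma integral_close (R : realType) (mu : probability R R) (r y : R) :
  (\int[mu]_x (close r x y)%:E = (ball_mass mu r y)%:E)%E.
Proof.
under eq_integral do rewrite closeE.
by rewrite integral_indic// ?setIT ?ball_mass_EFin//; exact: measurable_ball.
Qed.

Lemma ball_mass01 (R : realType) (mu : probability R R) (r y : R) :
  0 <= ball_mass mu r y <= 1.
Proof.
have mB : measurable (ball y r) by exact: measurable_ball.
rewrite -!lee_fin ball_mass_EFin measure_ge0/=.
exact: probability_le1.
Qed.

(** The mass of the ball is a difference of two values of distribution functions, taken at y + r and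
    y - r, each nondecreasing in y. *)
Lemma unit_bv_ball_mass (R : realType) (mu : probability R R) (r : R) :
  0 < r -> unit_bv (ball_mass mu r).
Proof.
move=> r0; split=> [x|]; first exact: ball_mass01.
have fm01 (A : set R) : measurable A -> 0 <= fine (mu A) <= 1.
  move=> mA; have fA : mu A \is a fin_num by exact: fin_num_measure.
  by rewrite -!lee_fin fineK// measure_ge0 probability_le1.
have fmS (A B : set R) : measurable A -> measurable B -> A `<=` B ->
    fine (mu A) <= fine (mu B).
  move=> mA mB AB; apply: fine_le; rewrite ?fin_num_measure//.
  by apply: le_measure; rewrite ?inE.
exists (fun y => fine (mu [set` `]-oo, (y + r)[])), (fun y => fine (mu [set` `]-oo, (y - r)]])).
split.
- move=> a b ab; apply: fmS => // z /=; rewrite !in_itv/=; lra.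
- move=> a b ab; apply: fmS => // z /=; rewrite !in_itv/=; lra.
- by move=> x; exact: fm01.
- by move=> x; exact: fm01.
apply/funext => y; rewrite /ball_mass /=.
have -> : ball y r = [set` `]-oo, (y + r)[] `\` [set` `]-oo, (y - r)]].
  apply/seteqP; split => z; rewrite /ball /= ltr_norml !in_itv/=.
    by move=> ?; split; [lra|apply/negP; rewrite -ltNge; lra].
  by move=> [? /negP]; rewrite -ltNge => ?; lra.
rewrite measureD//.
  rewrite fineB ?fin_num_measure//; last exact: measurableI.
  congr (_ - fine (mu _)); apply/seteqP; split => z /=; rewrite !in_itv/=.
    by case.
  by move=> ?; split => //; lra.
by rewrite -ge0_fin_numE// fin_num_measure.
Qed.

(* [A] is contained in [ball x r] for every [x] in [A]. *)
Lemma measure_diam_sqr_le (R : realType) (mu : probability R R) (r : R)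
    (A : set R) :
  0 < r -> measurable A -> (forall x y, A x -> A y -> `|x - y| < r) ->
  (mu A * mu A <= \int[mu]_y (ball_mass mu r y)%:E)%E.
Proof.
move=> r0 mA dA.
have mbm := measurable_unit_bv (unit_bv_ball_mass mu r0).
have fA : mu A \is a fin_num by exact: fin_num_measure.
rewrite -[X in (X * _)%E](fineK fA).
rewrite -[in X in (_ * X)%E](setIT A) -integral_indic//.
rewrite -ge0_integralZl//; last 2 first.
- exact/measurable_EFinP/measurable_indic.
- by rewrite lee_fin fine_ge0.
apply: ge0_le_integral => //.
- by move=> x _; rewrite mule_ge0 // lee_fin fine_ge0.
- by apply: measurable_funeM; exact/measurable_EFinP/measurable_indic.
- exact/measurable_EFinP.
move=> x _; rewrite indicE; case: (boolP (x \in A)) => /= [|_]; last first.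
  by rewrite mule0 lee_fin; case/andP: (ball_mass01 mu r x).
rewrite inE => Ax; rewrite mule1 fineK// ball_mass_EFin.
by apply: le_measure; rewrite ?inE//; [exact: measurable_ball|move=> y Ay; exact: dA].
Qed.

Lemma ball_mass_le_sqrt (R : realType) (mu : probability R R) (r y : R) :
  0 < r ->
  ball_mass mu r y <=
    2 * Num.sqrt (fine (\int[mu]_y (ball_mass mu r y)%:E)%E).
Proof.
move=> r0; set A := fine _.
have mbm := measurable_unit_bv (unit_bv_ball_mass mu r0).
have half (I : set R) : measurable I ->
    (forall x y, I x -> I y -> `|x - y| < r) -> fine (mu I) <= Num.sqrt A.
  move=> mI dI; have fI : mu I \is a fin_num by exact: fin_num_measure.
  rewrite -(ler_pXn2r (_ : (0 < 2)%N)) ?nnegrE ?fine_ge0 ?sqrtr_ge0//.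
  have fin := integral_unit_fin_num mu mbm (ball_mass01 mu r).
  rewrite sqr_sqrtr; last first.
    apply: fine_ge0; apply: integral_ge0 => x _.
    by rewrite lee_fin; case/andP: (ball_mass01 mu r x).
  rewrite -lee_fin /A fineK// expr2 EFinM fineK//.
  exact: measure_diam_sqr_le.
(* The centre is assigned to the right half. In both halves any two points are at distance strictly
   less than [r], which fails for the ball itself. *)
have hl : fine (mu [set` `]y - r, y[]) <= Num.sqrt A.
  by apply: half => // a b; rewrite /= !in_itv/= ltr_norml; lra.
have hr : fine (mu [set` `[y, y + r[]) <= Num.sqrt A.
  by apply: half => // a b; rewrite /= !in_itv/= ltr_norml; lra.
have : ball_mass mu r y <= fine (mu [set` `]y - r, y[]) + fine (mu [set` `[y, y + r[]).
  rewrite -lee_fin ball_mass_EFin EFinD !fineK ?fin_num_measure//.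
  have -> : ball y r = [set` `]y - r, y[] `|` [set` `[y, y + r[].
    apply/seteqP; split => z; rewrite /ball /= ltr_norml !in_itv/=.
      by move=> ?; case: (ltP z y) => ?; [left|right]; lra.
    by case; lra.
  exact: measureU2.
lra.
Qed.

(** By invariance the smaller of the two times can be shifted to 0, after which mixing applies at
    the time difference. Subtraction in [nat] truncates, so [i - j + (j - i)] is the distance |i -
    j|. *)
Lemma correlation_le (R : realType) (T : R -> R) (mu : probability R R)
    (K theta : R) (psi phi : R -> R) (i j : nat) :
  preserves T mu -> mixing_upper_bound T mu K theta ->
  unit_bv psi -> unit_bv phi ->
  (\int[mu]_x (psi (iter i T x) * phi (iter j T x))%:E <=
   \int[mu]_x (psi x)%:E * \int[mu]_x (phi x)%:E
     + (K * expR (- theta * (i - j + (j - i))%:R))%:E)%E.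
Proof.
move=> pT mix.
have mT := pT.1.
wlog ij : i j psi phi / (i <= j)%N => [wl|] bpsi bphi.
  have /orP[ij|ji] := leq_total i j; first exact: wl.
  rewrite muleC [(i - j + _)%N]addnC.
  under eq_integral do rewrite mulrC.
  exact: wl.
have mpsi := measurable_unit_bv bpsi; have mphi := measurable_unit_bv bphi.
have -> : (i - j + (j - i))%N = (j - i)%N by lia.
under eq_integral do rewrite -{1}(subnK ij) iterD.
rewrite (@preserves_integral_iter _ _ _
  (fun x => (psi x * phi (iter (j - i) T x))%:E))//.
- exact: mix.
- apply/measurable_EFinP; apply: measurable_funM => //.
  by apply: measurableT_comp => //; exact: measurable_iter.
- by move=> x; rewrite lee_fin mulr_ge0//;
    [case/andP: (bpsi.1 x)|case/andP: (bphi.1 (iter (j - i) T x))].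
Qed.

(** * Correlations of close encounters *)

Definition hit (R : realType) (T S : R -> R) (r : R) (i j : nat)
    (p : R * R) : R :=
  close r (iter i T p.1) (iter j S p.2).

Lemma hit01 (R : realType) (T S : R -> R) (r : R) (i j : nat) (p : R * R) :
  0 <= hit T S r i j p <= 1.
Proof. exact: close01. Qed.

Lemma hit_ge0 (R : realType) (T S : R -> R) (r : R) (i j : nat) (p : R * R) :
  0 <= hit T S r i j p.
Proof. by case/andP: (hit01 T S r i j p). Qed.

Lemma hit_le1 (R : realType) (T S : R -> R) (r : R) (i j : nat) (p : R * R) :
  hit T S r i j p <= 1.
Proof. by case/andP: (hit01 T S r i j p). Qed.

Lemma hit_swap (R : realType) (T S : R -> R) (r : R) (i j : nat) (x y : R) :
  hit T S r i j (x, y) = hit S T r j i (y, x).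
Proof. exact: closeC. Qed.

Lemma measurable_hit (R : realType) (T S : R -> R) (r : R) (i j : nat) :
  measurable_fun setT T -> measurable_fun setT S ->
  measurable_fun setT (hit T S r i j).
Proof.
move=> mT mS; apply: measurable_close.
- by apply: measurableT_comp => //; exact: measurable_iter.
- by apply: measurableT_comp => //; exact: measurable_iter.
Qed.

Lemma integral_hitx (R : realType) (T S : R -> R) (mu : probability R R)
    (r : R) (i j : nat) (y : R) :
  preserves T mu ->
  (\int[mu]_x (hit T S r i j (x, y))%:E = (ball_mass mu r (iter j S y))%:E)%E.
Proof.
move=> pT; rewrite -integral_close /hit/=.
apply: (@preserves_integral_iter _ _ _ (fun x => (close r x _)%:E)) => //.
- by apply/measurable_EFinP; apply: measurable_close.
- by move=> x; rewrite lee_fin; case/andP: (close01 r x (iter j S y)).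
Qed.

Lemma integral_hit (R : realType) (T S : R -> R) (mu nu : probability R R)
    (r : R) (i j : nat) :
  0 < r -> preserves T mu -> preserves S nu ->
  (\int[nu]_y \int[mu]_x (hit T S r i j (x, y))%:E
    = \int[nu]_y (ball_mass mu r y)%:E)%E.
Proof.
move=> r0 pT pS; under eq_integral do rewrite integral_hitx//.
have bm := unit_bv_ball_mass mu r0.
rewrite (@preserves_integral_iter _ _ _ (fun y => (ball_mass mu r y)%:E))//.
- by apply/measurable_EFinP; exact: measurable_unit_bv bm.
- by move=> x; rewrite lee_fin; case/andP: (bm.1 x).
Qed.

(** For fixed [y] both hits are indicators, evaluated along the orbit of [x], of balls around points
    of the orbit of [y]; mixing of [T] decouples them. *)
Lemma integral_hit2x_le (R : realType) (T S : R -> R) (mu : probability R R)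
    (K theta r : R) (i j i' j' : nat) (y : R) :
  0 < r -> preserves T mu -> mixing_upper_bound T mu K theta ->
  (\int[mu]_x (hit T S r i j (x, y) * hit T S r i' j' (x, y))%:E <=
   (ball_mass mu r (iter j S y) * ball_mass mu r (iter j' S y)
     + K * expR (- theta * (i - i' + (i' - i))%:R))%:E)%E.
Proof.
move=> r0 pT mix; rewrite EFinD EFinM -!integral_close.
exact: (@correlation_le _ _ _ _ _ (fun x => close r x (iter j S y))
  (fun x => close r x (iter j' S y)) i i' pT mix
  (unit_bv_close _ r0) (unit_bv_close _ r0)).
Qed.

Lemma measurable_hit2 (R : realType) (T S : R -> R)
    (r : R) (i j i' j' : nat) :
  measurable_fun setT T -> measurable_fun setT S ->
  measurable_fun setT (fun p => (hit T S r i j p * hit T S r i' j' p)%:E).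
Proof.
move=> mT mS; apply/measurable_EFinP.
by apply: measurable_funM; exact: measurable_hit.
Qed.

(** The previous bound integrated in [y]; its error does not depend on [y] and keeps its value
    because [nu] is a probability. *)
Lemma integral_hit2_le_corr (R : realType) (T S : R -> R)
    (mu nu : probability R R) (K theta r : R) (i j i' j' : nat) :
  0 < r -> 0 <= K -> preserves T mu -> preserves S nu ->
  mixing_upper_bound T mu K theta ->
  (\int[nu]_y \int[mu]_x (hit T S r i j (x, y) * hit T S r i' j' (x, y))%:E <=
   \int[nu]_y (ball_mass mu r (iter j S y) * ball_mass mu r (iter j' S y))%:E
     + (K * expR (- theta * (i - i' + (i' - i))%:R))%:E)%E.
Proof.
move=> r0 K0 pT pS mix.
have mbm := measurable_unit_bv (unit_bv_ball_mass mu r0).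
have bm0 x : 0 <= ball_mass mu r x by case/andP: (ball_mass01 mu r x).
set e := K * _; have e0 : 0 <= e by rewrite mulr_ge0// expR_ge0.
have mbb : measurable_fun setT
    (fun y => (ball_mass mu r (iter j S y) * ball_mass mu r (iter j' S y))%:E).
  apply/measurable_EFinP; apply: measurable_funM;
    by apply: measurableT_comp => //; exact: measurable_iter pS.1.
rewrite -(integral_prob_cst nu e) -ge0_integralD//; last first.
  by move=> y _; rewrite lee_fin mulr_ge0.
apply: ge0_le_integral => //.
- by move=> y _; apply: integral_ge0 => x _; rewrite lee_fin mulr_ge0 ?hit_ge0.
- apply: (@measurable_fun_fubini_tonelli_G _ _ _ _ _ mu
    (fun p => (hit T S r i j p * hit T S r i' j' p)%:E)).
    exact: measurable_hit2 pT.1 pS.1.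
  by move=> p; rewrite lee_fin mulr_ge0 ?hit_ge0.
- exact: emeasurable_funD.
by move=> y _; exact: integral_hit2x_le.
Qed.

(** After mixing in [x], what remains is a correlation of the map y |-> mu (ball y r) with itself
    along the orbit of [S], so mixing of [S] applies. *)
Lemma integral_hit2_le_far (R : realType) (T S : R -> R)
    (mu nu : probability R R) (K theta K' theta' r : R) (i j i' j' : nat) :
  0 < r -> 0 <= K -> preserves T mu -> preserves S nu ->
  mixing_upper_bound T mu K theta -> mixing_upper_bound S nu K' theta' ->
  (\int[nu]_y \int[mu]_x (hit T S r i j (x, y) * hit T S r i' j' (x, y))%:E <=
   \int[nu]_y (ball_mass mu r y)%:E * \int[nu]_y (ball_mass mu r y)%:E
     + (K' * expR (- theta' * (j - j' + (j' - j))%:R))%:E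
     + (K * expR (- theta * (i - i' + (i' - i))%:R))%:E)%E.
Proof.
move=> r0 K0 pT pS mix mix'; have bm := unit_bv_ball_mass mu r0.
apply: (le_trans (integral_hit2_le_corr _ _ _ _ r0 K0 pT pS mix)).
by apply: leeD => //; exact: correlation_le.
Qed.

(** For close [j] and [j'], where mixing of [S] gives nothing useful: one ball mass is replaced by
    its bound [c], the other is integrated. *)
Lemma integral_hit2_le_sup (R : realType) (T S : R -> R)
    (mu nu : probability R R) (K theta r c : R) (i j i' j' : nat) :
  0 < r -> 0 <= K -> preserves T mu -> preserves S nu ->
  mixing_upper_bound T mu K theta -> (forall y, ball_mass mu r y <= c) ->
  (\int[nu]_y \int[mu]_x (hit T S r i j (x, y) * hit T S r i' j' (x, y))%:E <=
   c%:E * \int[nu]_y (ball_mass mu r y)%:E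
     + (K * expR (- theta * (i - i' + (i' - i))%:R))%:E)%E.
Proof.
move=> r0 K0 pT pS mix bmc; have bm := unit_bv_ball_mass mu r0.
have mbm := measurable_unit_bv bm.
have bm0 x : 0 <= ball_mass mu r x by case/andP: (ball_mass01 mu r x).
apply: (le_trans (integral_hit2_le_corr _ _ _ _ r0 K0 pT pS mix)).
apply: leeD => //.
have c0 : 0 <= c := le_trans (bm0 0) (bmc 0).
rewrite -ge0_integralZl//; [|exact/measurable_EFinP|by move=> x _; rewrite lee_fin].
(* Invariance of [nu] puts the iterate of order [j'] back into the right-hand integral, so that the
   comparison becomes pointwise. *)
rewrite -(@preserves_integral_iter _ _ _
  (fun y => (c%:E * (ball_mass mu r y)%:E)%E) j' pS); last 2 first.
- by apply: measurable_funeM; exact/measurable_EFinP.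
- by move=> x; rewrite mule_ge0// lee_fin.
have mbmi k : measurable_fun setT (fun y => ball_mass mu r (iter k S y)).
  by apply: measurableT_comp => //; exact: measurable_iter pS.1.
apply: ge0_le_integral => //.
- by move=> y _; rewrite lee_fin mulr_ge0.
- by apply/measurable_EFinP; apply: measurable_funM.
- by apply: measurable_funeM; exact/measurable_EFinP.
by move=> y _; rewrite lee_fin ler_wpM2r.
Qed.

(** The second hit is at most 1 and is dropped. *)
Lemma integral_hit2_le_near (R : realType) (T S : R -> R)
    (mu nu : probability R R) (r : R) (i j i' j' : nat) :
  0 < r -> preserves T mu -> preserves S nu ->
  (\int[nu]_y \int[mu]_x (hit T S r i j (x, y) * hit T S r i' j' (x, y))%:E <=
   \int[nu]_y (ball_mass mu r y)%:E)%E.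
Proof.
move=> r0 pT pS; rewrite -(@integral_hit _ T S mu nu r i j)//.
have mh2 := measurable_hit2 r i j i' j' pT.1 pS.1.
have mh : measurable_fun setT (fun p => (hit T S r i j p)%:E).
  by apply/measurable_EFinP; exact: measurable_hit pT.1 pS.1.
apply: ge0_le_integral => //.
- by move=> y _; apply: integral_ge0 => x _; rewrite lee_fin mulr_ge0 ?hit_ge0.
- apply: (@measurable_fun_fubini_tonelli_G _ _ _ _ _ mu _ mh2).
  by move=> p; rewrite lee_fin mulr_ge0 ?hit_ge0.
- apply: (@measurable_fun_fubini_tonelli_G _ _ _ _ _ mu _ mh).
  by move=> p; rewrite lee_fin ?hit_ge0.
move=> y _; apply: ge0_le_integral => //.
- by move=> x _; rewrite lee_fin mulr_ge0 ?hit_ge0.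
- by apply: (measurableT_comp mh2); exact: measurable_pair2.
- by apply: (measurableT_comp mh); exact: measurable_pair2.
by move=> x _; rewrite lee_fin ler_piMr ?hit_ge0 ?hit_le1.
Qed.

Lemma product_prob_setT (R : realType) (mu nu : probability R R) :
  ((mu \x nu) setT = 1)%E.
Proof.
rewrite -setXTT product_measure1E// -[RHS]mule1.
by congr (_ * _)%E; exact: probability_setT.
Qed.

Lemma integral_product_hit (R : realType) (T S : R -> R)
    (mu nu : probability R R) (r : R) (i j : nat) :
  0 < r -> preserves T mu -> preserves S nu ->
  (\int[mu \x nu]_p (hit T S r i j p)%:E
    = \int[nu]_y (ball_mass mu r y)%:E)%E.
Proof.
move=> r0 pT pS; rewrite fubini_tonelli2.
- exact: integral_hit.
- by apply/measurable_EFinP; exact: measurable_hit pT.1 pS.1.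
- by move=> p; rewrite lee_fin hit_ge0.
Qed.

(** Both sides are the product measure of the pairs at distance less than [r]. This makes the two
    systems interchangeable. *)
Lemma integral_ball_mass_swap (R : realType) (mu nu : probability R R) (r : R) :
  0 < r ->
  (\int[mu]_x (ball_mass nu r x)%:E = \int[nu]_y (ball_mass mu r y)%:E)%E.
Proof.
move=> r0; pose f (p : R * R) := (close r p.1 p.2)%:E.
have := @fubini_tonelli _ _ _ _ _ mu nu f.
rewrite /fubini_F /fubini_G /f /=.
under eq_integral do under eq_integral do rewrite closeC.
under eq_integral do rewrite integral_close.
under [in X in _ = X]eq_integral do rewrite integral_close.
apply.
- by apply/measurable_EFinP; exact: measurable_closeT.
- by move=> p; rewrite lee_fin; case/andP: (close01 r p.1 p.2).
Qed.

Lemma integral_product_hit2 (R : realType) (T S : R -> R)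
    (mu nu : probability R R) (r : R) (i j i' j' : nat) :
  measurable_fun setT T -> measurable_fun setT S ->
  (\int[mu \x nu]_p (hit T S r i j p * hit T S r i' j' p)%:E =
   \int[nu]_y \int[mu]_x (hit T S r i j (x, y) * hit T S r i' j' (x, y))%:E)%E.
Proof.
move=> mT mS; rewrite fubini_tonelli2//.
- exact: measurable_hit2.
- by move=> p; rewrite lee_fin mulr_ge0 ?hit_ge0.
Qed.

(** With [y] integrated first, mixing of [S] can be used on its own; this serves the case of close
    [i] and [i'] but distant [j] and [j']. *)
Lemma integral_product_hit2_swap (R : realType) (T S : R -> R)
    (mu nu : probability R R) (r : R) (i j i' j' : nat) :
  measurable_fun setT T -> measurable_fun setT S ->
  (\int[mu \x nu]_p (hit T S r i j p * hit T S r i' j' p)%:E =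
   \int[mu]_x \int[nu]_y (hit S T r j i (y, x) * hit S T r j' i' (y, x))%:E)%E.
Proof.
move=> mT mS; rewrite fubini_tonelli1.
- apply: eq_integral => x _; rewrite /fubini_F.
  by apply: eq_integral => y _; rewrite !(hit_swap T S).
- exact: measurable_hit2.
- by move=> p; rewrite lee_fin mulr_ge0 ?hit_ge0.
Qed.

(** * Second moment *)

Lemma second_moment_method (R : realType) (d : measure_display)
    (T : measurableType d) (P : {measure set T -> \bar R}) (S : T -> R)
    (m V : R) :
  P setT = 1%E -> measurable_fun setT S -> (forall x, 0 <= S x) -> 0 < m ->
  (\int[P]_x (S x)%:E = m%:E)%E -> (\int[P]_x (S x ^+ 2)%:E <= V%:E)%E ->
  (P [set x | S x = 0%R] <= (V / m ^+ 2 - 1)%:E)%E.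
Proof.
move=> P1 mS S0 m0 ES ES2; set Z := [set x | S x = 0].
have m20 : 0 < m ^+ 2 by rewrite exprn_gt0.
have mZ : measurable Z.
  by rewrite -[Z]setTI; exact: (mS measurableT [set 0] (measurable_set1 _)).
have mS1 : measurable_fun setT (fun x => (S x)%:E) by exact/measurable_EFinP.
have mS2 : measurable_fun setT (fun x => (S x ^+ 2)%:E).
  by apply/measurable_EFinP; exact: measurable_funX.
have mI : measurable_fun setT (fun x => (\1_Z x : R)%:E).
  exact/measurable_EFinP/measurable_indic.
have c0 : 0 <= 2 / m by rewrite divr_ge0// ltW.
have i0 : 0 <= (m ^+ 2)^-1 by rewrite invr_ge0 ltW.
(* The inequality 1_Z <= (S / m - 1)^2 with its cross term moved to the left: both integrands are
   then nonnegative and no integrals are subtracted. *)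
have step : (\int[P]_x ((\1_Z x)%:E + (2 / m)%:E * (S x)%:E) <=
    \int[P]_x (((m ^+ 2)^-1)%:E * (S x ^+ 2)%:E + 1%:E))%E.
  apply: ge0_le_integral => //.
  - by move=> x _; rewrite lee_fin addr_ge0// mulr_ge0.
  - by apply: emeasurable_funD => //; exact: measurable_funeM.
  - by apply: emeasurable_funD => //; exact: measurable_funeM.
  move=> x _; rewrite -!EFinM -!EFinD lee_fin indicE.
  have [xZ|xZ] := boolP (x \in Z).
    by move: xZ; rewrite inE /Z/= => ->; rewrite expr0n/= !mulr0 addr0 add0r.
  rewrite add0r; have : 0 <= (S x / m - 1) ^+ 2 by exact: sqr_ge0.
  have -> : (S x / m - 1) ^+ 2 =
      (m ^+ 2)^-1 * S x ^+ 2 + 1 - 2 / m * S x by field; exact: lt0r_neq0.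
  by rewrite subr_ge0.
move: step; rewrite ge0_integralD//; last 2 first.
- by move=> x _; rewrite -EFinM lee_fin mulr_ge0.
- exact: measurable_funeM.
rewrite integral_indic// setIT.
rewrite ge0_integralZl//; last by move=> x _; rewrite lee_fin.
rewrite ES -EFinM (divfK (lt0r_neq0 m0)).
rewrite ge0_integralD//; last 2 first.
- by move=> x _; rewrite -EFinM lee_fin mulr_ge0// sqr_ge0.
- exact: measurable_funeM.
rewrite ge0_integralZl//; last by move=> x _; rewrite lee_fin sqr_ge0.
rewrite integral_cst// P1 mule1 => step.
have ES2' : (((m ^+ 2)^-1)%:E * \int[P]_x (S x ^+ 2)%:E <= (V / m ^+ 2)%:E)%E.
  by rewrite mulrC EFinM; apply: lee_wpmul2l.
have step2 : (P Z + 2%:E <= (V / m ^+ 2 + 1)%:E)%E.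
  by rewrite [leRHS]EFinD; apply: (le_trans step); exact: leeD.
have -> : V / m ^+ 2 - 1 = V / m ^+ 2 + 1 - 2 by ring.
by rewrite EFinB leeBrDr.
Qed.

(** * Counting quadruples of times near the diagonals *)

(** Real-valued, so that the cases near or far in each coordinate merge into one expression whose
    sum factors. *)
Definition near_diag (R : realType) (k i j : nat) : R :=
  (i - j + (j - i) <= k)%N%:R.

Lemma sum_near_le (R : realType) (k n i : nat) :
  \sum_(j < n) near_diag R k i j <= (2 * k + 1)%:R.
Proof.
rewrite -natr_sum ler_nat -(big_mkord xpredT
  (fun j => nat_of_bool (i - j + (j - i) <= k)%N)).
rewrite -big_mkcond/= /index_iota sum1_count -size_filter subn0.
(* The admissible [j] lie in the window of length 2k + 1 starting at [i - k]; when i < k the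
   truncated start 0 still leaves room up to i + k. *)
rewrite -[leqRHS](size_iota (i - k) (2 * k + 1)).
apply: uniq_leq_size; first by rewrite filter_uniq ?iota_uniq.
by move=> j; rewrite mem_filter !mem_iota; lia.
Qed.

Lemma sum_near2_le (R : realType) (k n : nat) :
  \sum_(i < n) \sum_(j < n) near_diag R k i j <= n%:R * (2 * k + 1)%:R.
Proof.
rewrite mulr_natl -[in leRHS](card_ord n) -sumr_const.
by apply: ler_sum => i _; exact: sum_near_le.
Qed.

(** Here [a] and [b] are the pairs (i, j) and (i', j'). Regrouping the quadruple by coordinates
    separates the sum over (i, i') from the one over (j, j'). *)
Lemma sum_pair_mul (R : realType) (n : nat) (c e : nat -> nat -> R) :
  \sum_(a : 'I_n * 'I_n) \sum_(b : 'I_n * 'I_n) c a.1 b.1 * e a.2 b.2 =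
  (\sum_(i < n) \sum_(j < n) c i j) * (\sum_(i < n) \sum_(j < n) e i j).
Proof.
rewrite [RHS]big_distrlr/= [RHS]pair_bigA/=; apply: eq_bigr => a _.
by rewrite [RHS]big_distrlr/= [RHS]pair_bigA.
Qed.

(** There are n^4 quadruples; at most n^3 (2k + 1) are near in a given coordinate, and at most n^2
    (2k + 1)^2 in both. *)
Lemma sum_near_profile_le (R : realType) (n k : nat) (u v w z : R) :
  0 <= v -> 0 <= w -> 0 <= z ->
  \sum_(a : 'I_n * 'I_n) \sum_(b : 'I_n * 'I_n)
    (u + near_diag R k a.2 b.2 * v + near_diag R k a.1 b.1 * w
      + near_diag R k a.1 b.1 * near_diag R k a.2 b.2 * z) <=
  n%:R ^+ 4 * u + n%:R ^+ 3 * (2 * k + 1)%:R * (v + w)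
    + n%:R ^+ 2 * (2 * k + 1)%:R ^+ 2 * z.
Proof.
move=> v0 w0 z0; set N := (2 * k + 1)%:R.
pose s := \sum_(i < n) \sum_(j < n) near_diag R k i j.
have s1 : \sum_(i < n) \sum_(j < n) (1 : R) = n%:R ^+ 2.
  by rewrite !sumr_const !card_ord -mulrnA natrM expr2.
have sN : s <= n%:R * N := sum_near2_le R k n.
have s0 : 0 <= s by apply: sumr_ge0 => i _; apply: sumr_ge0 => j _; exact: ler0n.
have n0 : 0 <= n%:R :> R by [].
have N0 : 0 <= N by [].
have -> : \sum_(a : 'I_n * 'I_n) \sum_(b : 'I_n * 'I_n)
    (u + near_diag R k a.2 b.2 * v + near_diag R k a.1 b.1 * w
      + near_diag R k a.1 b.1 * near_diag R k a.2 b.2 * z) =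
    n%:R ^+ 2 * n%:R ^+ 2 * u + n%:R ^+ 2 * s * v + s * n%:R ^+ 2 * w
      + s * s * z.
  rewrite -s1 /s -(sum_pair_mul n (fun=> fun=> 1) (fun=> fun=> 1)).
  rewrite -(sum_pair_mul n (fun=> fun=> 1) (near_diag R k)).
  rewrite -(sum_pair_mul n (near_diag R k) (fun=> fun=> 1)).
  rewrite -(sum_pair_mul n (near_diag R k) (near_diag R k)).
  rewrite !mulr_suml -!big_split/=; apply: eq_bigr => a _.
  rewrite !mulr_suml -!big_split/=; apply: eq_bigr => b _.
  by rewrite !mul1r !mulr1.
have e1 : n%:R ^+ 2 * s * v <= n%:R ^+ 3 * N * v.
  apply: ler_wpM2r => //; rewrite [in leRHS]exprSr -mulrA.
  by apply: ler_wpM2l => //; exact: exprn_ge0.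
have e2 : s * n%:R ^+ 2 * w <= n%:R ^+ 3 * N * w.
  apply: ler_wpM2r => //; rewrite [in leRHS]exprSr -mulrA [leLHS]mulrC.
  by apply: ler_wpM2l => //; exact: exprn_ge0.
have e3 : s * s * z <= n%:R ^+ 2 * N ^+ 2 * z.
  apply: ler_wpM2r => //; rewrite -exprMn -expr2.
  by rewrite ler_pXn2r// ?nnegrE ?mulr_ge0.
have -> : n%:R ^+ 4 = n%:R ^+ 2 * n%:R ^+ 2 :> R by rewrite -exprD.
rewrite mulrDr; lra.
Qed.

(** Lets the two systems share one pair of constants. *)
Lemma mixing_upper_bound_weaken (R : realType) (T : R -> R)
    (mu : probability R R) (K K' theta theta' : R) :
  0 <= K -> K <= K' -> theta' <= theta ->
  mixing_upper_bound T mu K theta -> mixing_upper_bound T mu K' theta'.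
Proof.
move=> K0 KK' tt' mix psi phi n bpsi bphi.
apply: (le_trans (mix _ _ n bpsi bphi)); apply: leeD => //.
rewrite lee_fin; apply: ler_pM => //.
by rewrite ler_expR ler_wpM2r// lerN2.
Qed.

Lemma integral_product_hit2_le (R : realType) (T S : R -> R)
    (mu nu : probability R R) (K theta delta r M c c' : R) (k i j i' j' : nat) :
  0 < r -> 0 <= K -> 0 <= theta -> preserves T mu -> preserves S nu ->
  mixing_upper_bound T mu K theta -> mixing_upper_bound S nu K theta ->
  K * expR (- theta * k%:R) <= delta ->
  (forall y, ball_mass mu r y <= c) -> (forall x, ball_mass nu r x <= c') ->
  (\int[nu]_y (ball_mass mu r y)%:E = M%:E)%E ->
  (\int[mu \x nu]_p (hit T S r i j p * hit T S r i' j' p)%:E <=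
    (M ^+ 2 + 2 * delta + near_diag R k j j' * (c * M + delta)
      + near_diag R k i i' * (c' * M + delta) + near_diag R k i i' * near_diag R k j j' * M)%:E)%E.
Proof.
move=> r0 K0 th0 pT pS mT mS Kdelta bc bc' ME.
have delta0 : 0 <= delta by apply: le_trans Kdelta; rewrite mulr_ge0 ?expR_ge0.
have M0 : 0 <= M.
  rewrite -lee_fin -ME; apply: integral_ge0 => y _.
  by rewrite lee_fin; case/andP: (ball_mass01 mu r y).
have bm0 (m : probability R R) x : 0 <= ball_mass m r x.
  by case/andP: (ball_mass01 m r x).
have c0 : 0 <= c := le_trans (bm0 mu 0) (bc 0).
have c0' : 0 <= c' := le_trans (bm0 nu 0) (bc' 0).
have cM : 0 <= c * M by rewrite mulr_ge0.
have cM' : 0 <= c' * M by rewrite mulr_ge0.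
have M20 : 0 <= M ^+ 2 by rewrite sqr_ge0.
(* The error decreases in the gap, so [delta] controls it for every gap beyond [k]. *)
have far t : (k < t)%N -> K * expR (- theta * t%:R) <= delta.
  move=> kt; apply: le_trans Kdelta; apply: ler_wpM2l => //; rewrite ler_expR !mulNr lerN2.
  by apply: ler_wpM2l => //; rewrite ler_nat ltnW.
have ME' : (\int[mu]_x (ball_mass nu r x)%:E = M%:E)%E.
  by rewrite integral_ball_mass_swap.
(* Four cases, the gap in [j] being tested first: near in both, near in [j] only, near in [i] only,
   far in both. Surplus terms of the bound are nonnegative. *)
rewrite /near_diag; case: leqP => [njj|/far fjj]; case: leqP => [nii|/far fii];
  rewrite /= ?mul1r ?mul0r ?addr0.
- rewrite integral_product_hit2 ?pT.1 ?pS.1//; [|exact: pT.1|exact: pS.1].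
  apply: (le_trans (integral_hit2_le_near _ _ _ _ r0 pT pS)).
  by rewrite ME lee_fin; lra.
- rewrite integral_product_hit2; [|exact: pT.1|exact: pS.1].
  apply: (le_trans (integral_hit2_le_sup _ _ _ _ r0 K0 pT pS mT bc)).
  by rewrite ME -EFinM -EFinD lee_fin; lra.
- rewrite integral_product_hit2_swap; [|exact: pT.1|exact: pS.1].
  apply: (le_trans (integral_hit2_le_sup _ _ _ _ r0 K0 pS pT mS bc')).
  by rewrite ME' -EFinM -EFinD lee_fin; lra.
- rewrite integral_product_hit2; [|exact: pT.1|exact: pS.1].
  apply: (le_trans (integral_hit2_le_far _ _ _ _ r0 K0 pT pS mT mS)).
  by rewrite ME -EFinM -!EFinD lee_fin -expr2; lra.
Qed.

(** * Moments of the number of close encounters *)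

(** The counting variable written S in the overview; in the code [S] is the second map. *)
Definition hits (R : realType) (T S : R -> R) (r : R) (n : nat) (p : R * R) : R :=
  \sum_(a : 'I_n * 'I_n) hit T S r a.1 a.2 p.

Lemma measurable_hits (R : realType) (T S : R -> R) (r : R) (n : nat) :
  measurable_fun setT T -> measurable_fun setT S ->
  measurable_fun setT (hits T S r n).
Proof.
move=> mT mS; apply: measurable_sum => a; exact: measurable_hit.
Qed.

Lemma hits_ge0 (R : realType) (T S : R -> R) (r : R) (n : nat) (p : R * R) :
  0 <= hits T S r n p.
Proof. by apply: sumr_ge0 => a _; exact: hit_ge0. Qed.

Lemma integral_hits (R : realType) (T S : R -> R)
    (mu nu : probability R R) (r M : R) (n : nat) :
  0 < r -> preserves T mu -> preserves S nu ->
  (\int[nu]_y (ball_mass mu r y)%:E = M%:E)%E ->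
  (\int[mu \x nu]_p (hits T S r n p)%:E = (n%:R ^+ 2 * M)%:E)%E.
Proof.
move=> r0 pT pS ME.
under eq_integral do rewrite /hits -sumEFin.
rewrite ge0_integral_sum//; last 2 first.
- by move=> a; apply/measurable_EFinP; exact: measurable_hit pT.1 pS.1.
- by move=> a p _; rewrite lee_fin hit_ge0.
under eq_bigr do rewrite integral_product_hit// ME.
by rewrite sumEFin sumr_const card_prod card_ord -natrX mulr_natl.
Qed.

(** The square expands over quadruples of times. The correlation bounds form a profile with u = M^2
    + 2 delta, v = c M + delta, w = c' M + delta and z = M, which is then summed. *)
Lemma integral_hits_sqr_le (R : realType) (T S : R -> R)
    (mu nu : probability R R) (K theta delta r M c c' : R) (k n : nat) :
  0 < r -> 0 <= K -> 0 <= theta -> preserves T mu -> preserves S nu ->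
  mixing_upper_bound T mu K theta -> mixing_upper_bound S nu K theta ->
  K * expR (- theta * k%:R) <= delta ->
  (forall y, ball_mass mu r y <= c) -> (forall x, ball_mass nu r x <= c') ->
  (\int[nu]_y (ball_mass mu r y)%:E = M%:E)%E ->
  (\int[mu \x nu]_p (hits T S r n p ^+ 2)%:E <=
    (n%:R ^+ 4 * (M ^+ 2 + 2 * delta)
      + n%:R ^+ 3 * (2 * k + 1)%:R * (c * M + delta + (c' * M + delta))
      + n%:R ^+ 2 * (2 * k + 1)%:R ^+ 2 * M)%:E)%E.
Proof.
move=> r0 K0 th0 pT pS mT mS Kdelta bc bc' ME.
have delta0 : 0 <= delta by apply: le_trans Kdelta; rewrite mulr_ge0 ?expR_ge0.
have M0 : 0 <= M.
  rewrite -lee_fin -ME; apply: integral_ge0 => y _.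
  by rewrite lee_fin; case/andP: (ball_mass01 mu r y).
have bm0 (m : probability R R) x : 0 <= ball_mass m r x.
  by case/andP: (ball_mass01 m r x).
have c0 : 0 <= c := le_trans (bm0 mu 0) (bc 0).
have c0' : 0 <= c' := le_trans (bm0 nu 0) (bc' 0).
have -> : (\int[mu \x nu]_p (hits T S r n p ^+ 2)%:E =
    \sum_(a : 'I_n * 'I_n) \sum_(b : 'I_n * 'I_n)
      \int[mu \x nu]_p (hit T S r a.1 a.2 p * hit T S r b.1 b.2 p)%:E)%E.
  under eq_integral do rewrite /hits expr2 big_distrlr/= -sumEFin.
  under eq_integral do under eq_bigr do rewrite -sumEFin.
  rewrite ge0_integral_sum//; last 2 first.
  - move=> a; apply: emeasurable_sum => b; exact: measurable_hit2 pT.1 pS.1.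
  - by move=> a p _; apply: sume_ge0 => b _; rewrite lee_fin mulr_ge0 ?hit_ge0.
  apply: eq_bigr => a _; rewrite ge0_integral_sum//.
  - by move=> b; exact: measurable_hit2 pT.1 pS.1.
  - by move=> b p _; rewrite lee_fin mulr_ge0 ?hit_ge0.
apply: (@le_trans _ _ (\sum_(a : 'I_n * 'I_n) \sum_(b : 'I_n * 'I_n)
    (M ^+ 2 + 2 * delta + near_diag R k a.2 b.2 * (c * M + delta)
      + near_diag R k a.1 b.1 * (c' * M + delta)
      + near_diag R k a.1 b.1 * near_diag R k a.2 b.2 * M))%:E).
  rewrite -sumEFin; apply: lee_sum => a _; rewrite -sumEFin.
  apply: lee_sum => b _.
  exact: (integral_product_hit2_le _ _ _ _ r0 K0 th0 pT pS mT mS Kdelta bc bc' ME).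
by rewrite lee_fin; apply: sum_near_profile_le => //;
  rewrite addr_ge0// mulr_ge0.
Qed.

Lemma measure_no_hits_le (R : realType) (T S : R -> R)
    (mu nu : probability R R) (K theta delta r M c c' : R) (k n : nat) :
  0 < r -> 0 <= K -> 0 <= theta -> preserves T mu -> preserves S nu ->
  mixing_upper_bound T mu K theta -> mixing_upper_bound S nu K theta ->
  K * expR (- theta * k%:R) <= delta ->
  (forall y, ball_mass mu r y <= c) -> (forall x, ball_mass nu r x <= c') ->
  (\int[nu]_y (ball_mass mu r y)%:E = M%:E)%E -> 0 < M -> (0 < n)%N ->
  ((mu \x nu) [set p | hits T S r n p = 0%R] <=
    (2 * (delta / M ^+ 2) + (2 * k + 1)%:R / n%:R * (c / M + c' / M + 2 * (delta / M ^+ 2))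
      + (2 * k + 1)%:R ^+ 2 / (n%:R ^+ 2 * M))%:E)%E.
Proof.
move=> r0 K0 th0 pT pS mT mS Kdelta bc bc' ME M0 n0.
have nR : 0 < n%:R :> R by rewrite ltr0n.
have m0 : 0 < n%:R ^+ 2 * M by rewrite mulr_gt0// exprn_gt0.
have := second_moment_method (product_prob_setT mu nu)
  (measurable_hits r n pT.1 pS.1) (hits_ge0 T S r n) m0
  (integral_hits n r0 pT pS ME)
  (integral_hits_sqr_le n r0 K0 th0 pT pS mT mS Kdelta bc bc' ME).
move=> /le_trans; apply.
(* The two sides are equal: division by (n^2 M)^2 turns n^4 M^2 into 1, which the subtracted 1
   cancels. *)
rewrite lee_fin le_eqVlt; apply/orP; left; apply/eqP.
have Mn : M != 0 by exact: lt0r_neq0.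
have nn : n%:R != 0 :> R by exact: lt0r_neq0.
by field; rewrite Mn nn.
Qed.

(** * Asymptotics *)

(** The complement of the limsup is the countable union of the sets [A k] of points in no [E n] with
    n >= k. Each [A k] sits inside complements of arbitrarily small measure, hence is null. *)
Lemma measure_limsup_set_full (R : realType) (d : measure_display)
    (T : measurableType d) (P : {measure set T -> \bar R}) (E : nat -> set T) :
  P setT = 1%E -> (forall n, measurable (E n)) ->
  (forall (e : R) (k : nat), 0 < e ->
    exists2 n, (k <= n)%N & (P (~` E n) <= e%:E)%E) ->
  P (limsup_set E) = 1%E.
Proof.
move=> P1 mE small.
pose A k := \bigcap_(n in [set n | (k <= n)%N]) ~` E n.
have mA k : measurable (A k).
  by apply: bigcap_measurable => [|n _]; [exists k => /=|exact: measurableC].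
have A0 k : P (A k) = 0%E.
  apply/eqP; rewrite eq_le measure_ge0 andbT.
  apply/lee_addgt0Pr => e e0; rewrite add0e.
  have [n kn Pn] := small e k e0; apply: le_trans Pn.
  by apply: le_measure; rewrite ?inE//; [exact: measurableC|exact: bigcap_inf].
have limsupC : ~` limsup_set E = \bigcup_k A k.
  rewrite /limsup_set setC_bigcap; apply: eq_bigcupr => k _.
  by rewrite setC_bigcup.
have mL : measurable (~` limsup_set E).
  by rewrite limsupC; exact: bigcupT_measurable.
have L0 : P (~` limsup_set E) = 0%E.
  apply/negligibleP => //; rewrite limsupC; apply: negligible_bigcup => k.
  by apply/(negligibleP _ (mA k)); exact: A0.
have mL' : measurable (limsup_set E) by rewrite -[limsup_set E]setCK; exact: measurableC.
rewrite -P1 -(setUv (limsup_set E)) measureU ?setICr//.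
by rewrite -[LHS]adde0; congr (_ + _)%E.
Qed.

(** To be read with L = ln n, N = 2k + 1, and [c], [c'] the bounds on ball masses. The mixing errors
    are O(1/n), the other terms O(1/h). *)
Lemma no_hits_estimate (R : realType) (n L h M delta N K c c' b : R) :
  1 <= L -> L <= n -> 1 <= h -> 0 <= K -> 0 <= b -> 0 <= delta ->
  L ^+ 2 * h / n ^+ 2 <= M -> c / M <= 2 * (n / (L * h)) ->
  c' / M <= 2 * (n / (L * h)) -> 0 <= N -> N <= b * L -> delta <= K / n ^+ 5 ->
  2 * (delta / M ^+ 2) + N / n * (c / M + c' / M + 2 * (delta / M ^+ 2))
    + N ^+ 2 / (n ^+ 2 * M) <=
  (2 * K + 2 * K * b) / n + (4 * b + b ^+ 2) / h.
Proof.
move=> L1 Ln h1 K0 b0 d0 MLh cM cM' N0 NL dK.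
have L0 : 0 < L by lra.
have n0 : 0 < n by lra.
have h0 : 0 < h by lra.
have M0 : 0 < M.
  by apply: lt_le_trans MLh; rewrite divr_gt0 ?mulr_gt0 ?exprn_gt0.
have n20 : 0 < n ^+ 2 by rewrite exprn_gt0.
have L20 : 0 < L ^+ 2 by rewrite exprn_gt0.
have L2h : 1 <= L ^+ 2 * h.
  by rewrite -[1]mul1r; apply: ler_pM => //; exact: exprn_ege1.
have nM : L ^+ 2 * h <= n ^+ 2 * M by rewrite [leRHS]mulrC -ler_pdivrMr.
(* The exponent 5 is chosen here: 1 / M^2 is at most n^4, and one factor 1 / n survives. *)
have dM : delta / M ^+ 2 <= K / n.
  rewrite ler_pdivrMr ?exprn_gt0//; apply: (le_trans dK).
  have -> : K / n ^+ 5 = K / n * (1 / n ^+ 4) by field; exact: lt0r_neq0.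
  apply: ler_wpM2l; first by rewrite divr_ge0// ltW.
  rewrite ler_pdivrMr ?exprn_gt0//.
  have -> : M ^+ 2 * n ^+ 4 = (n ^+ 2 * M) ^+ 2 by ring.
  by apply: exprn_ege1; exact: le_trans nM.
have Nn : N / n <= b.
  rewrite ler_pdivrMr//; apply: (le_trans NL); exact: ler_wpM2l.
have Nn0 : 0 <= N / n by rewrite divr_ge0// ltW.
(* The logarithm in N <= b L cancels the one in n / (L h), leaving only 1 / h. *)
have e1 : N / n * (c / M + c' / M) <= 4 * b / h.
  apply: (@le_trans _ _ (b * L / n * (4 * (n / (L * h))))); last first.
    rewrite le_eqVlt; apply/orP; left; apply/eqP; field.
    by rewrite !lt0r_neq0.
  apply: (@le_trans _ _ (N / n * (4 * (n / (L * h))))).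
    by apply: ler_wpM2l => //; lra.
  apply: ler_wpM2r; last by rewrite ler_pM2r ?invr_gt0.
  by rewrite mulr_ge0// divr_ge0 ?mulr_ge0 ?ltW.
have e2 : N / n * (2 * (delta / M ^+ 2)) <= b * (2 * (K / n)).
  apply: ler_pM => //; last lra.
  by rewrite mulr_ge0// divr_ge0// sqr_ge0.
(* N^2 costs L^2, which is exactly the squared logarithm in the lower bound on n^2 M. *)
have e3 : N ^+ 2 / (n ^+ 2 * M) <= b ^+ 2 / h.
  rewrite ler_pdivrMr; last exact: mulr_gt0.
  apply: (@le_trans _ _ ((b * L) ^+ 2)); first by rewrite ler_pXn2r ?nnegrE// mulr_ge0// ltW.
  apply: (@le_trans _ _ (b ^+ 2 / h * (L ^+ 2 * h))).
    rewrite le_eqVlt; apply/orP; left; apply/eqP; field.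
    by rewrite !lt0r_neq0.
  by apply: ler_wpM2l => //; rewrite divr_ge0 ?sqr_ge0 ?ltW.
have -> : (2 * K + 2 * K * b) / n + (4 * b + b ^+ 2) / h =
  2 * (K / n) + (4 * b / h + b * (2 * (K / n))) + b ^+ 2 / h.
  by field; rewrite !lt0r_neq0.
rewrite [N / n * (_ + _ + _)]mulrDr; lra.
Qed.

Lemma gap_exists (R : realType) (theta L : R) :
  0 < theta -> 1 <= L ->
  exists k : nat, 5 * L <= theta * k%:R /\
    (2 * k + 1)%:R <= (10 / theta + 3) * L.
Proof.
(* The successor of the truncation exceeds 5 L / theta; then 2k + 1 is at most 10 L / theta + 3, and
   3 <= 3 L since L >= 1. *)
move=> th0 L1; exists (Num.trunc (5 * L / theta)).+1.
have q0 : 0 <= 5 * L / theta by rewrite divr_ge0 ?ltW//; lra.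
have /andP[lo hi] := truncn_itv q0; split.
  by rewrite [leRHS]mulrC -ler_pdivrMr// ltW.
rewrite natrD natrM -natr1.
have -> : (10 / theta + 3) * L = 2 * (5 * L / theta) + 3 * L.
  by field; exact: lt0r_neq0.
lra.
Qed.

(** Combines the second moment bound with k ~ 5 ln n / theta, delta = K exp(- theta k), and twice
    the square roots of the self-correlation integrals as bounds on ball masses. *)
Lemma measure_no_hits_small (R : realType) (T S : R -> R)
    (mu nu : probability R R) (K theta r h M b : R) (n : nat) :
  0 < r -> 0 <= K -> 0 < theta -> preserves T mu -> preserves S nu ->
  mixing_upper_bound T mu K theta -> mixing_upper_bound S nu K theta ->
  (\int[nu]_y (ball_mass mu r y)%:E = M%:E)%E ->
  1 <= ln n%:R :> R -> 1 <= h ->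
  (ln n%:R) ^+ 2 * h / n%:R ^+ 2 <= M ->
  Num.sqrt (fine (\int[mu]_y (ball_mass mu r y)%:E)%E) / M
    <= n%:R / (ln n%:R * h) ->
  Num.sqrt (fine (\int[nu]_y (ball_mass nu r y)%:E)%E) / M
    <= n%:R / (ln n%:R * h) ->
  b = 10 / theta + 3 ->
  ((mu \x nu) [set p | hits T S r n p = 0%R] <=
    ((2 * K + 2 * K * b) / n%:R + (4 * b + b ^+ 2) / h)%:E)%E.
Proof.
move=> r0 K0 th0 pT pS mT mS ME L1 h1 LM cM cM' bE.
(* The totalised logarithm satisfies ln 0 <= 0, so [L1] excludes n = 0. *)
have n0 : (0 < n)%N.
  by case: n L1 {LM cM cM'} => // /le_trans/(_ (ln_le0 ler01)); rewrite ler10.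
have nR : 0 < n%:R :> R by rewrite ltr0n.
have eL : expR (ln n%:R) = n%:R :> R by rewrite lnK.
have Ln : ln n%:R <= n%:R :> R.
  by have := expR_ge1Dx (ln n%:R : R); rewrite eL; lra.
have M0 : 0 < M.
  apply: lt_le_trans LM; rewrite divr_gt0 ?exprn_gt0// mulr_gt0 ?exprn_gt0//; lra.
have [k [kth kN]] := gap_exists th0 L1; rewrite -bE in kN.
have dK : K * expR (- theta * k%:R) <= K / n%:R ^+ 5.
  apply: ler_wpM2l => //; rewrite -[in leRHS]eL -expRM_natl -expRN ler_expR.
  by rewrite mulNr lerN2.
apply: (le_trans (measure_no_hits_le r0 K0 (ltW th0) pT pS mT mS
  (lexx _) (fun y => ball_mass_le_sqrt mu y r0)
  (fun y => ball_mass_le_sqrt nu y r0) ME M0 n0)).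
rewrite lee_fin; apply: (no_hits_estimate L1 Ln h1 K0 _ _ LM _ _ _ kN dK) => //.
- by rewrite bE addr_ge0// divr_ge0// ltW.
- by rewrite mulr_ge0 ?expR_ge0.
- by rewrite -mulrA ler_wpM2l.
- by rewrite -mulrA ler_wpM2l.
Qed.

(** * From vanishing hit counts to the limsup set *)

Lemma measurable_no_hits (R : realType) (T S : R -> R) (r : R) (n : nat) :
  measurable_fun setT T -> measurable_fun setT S ->
  measurable [set p | hits T S r n p = 0].
Proof.
move=> mT mS; have mh := measurable_hits r n mT mS.
by rewrite -[X in measurable X]setTI; exact: (mh measurableT [set 0] (measurable_set1 _)).
Qed.

(** On X the extended maps have the original orbits, and a sum of nonnegative hits vanishes exactly
    when every hit does. *)
Lemma Eset_hits (R : realType) (X : set R) (T S : R -> R) (n : nat) (r : R) :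
  (forall x, X x -> X (T x)) -> (forall x, X x -> X (S x)) ->
  Eset X T S n r =
    (X `*` X) `&` ~` [set p | hits (extend_id X T) (extend_id X S) r n p = 0].
Proof.
move=> XT XS; apply/seteqP; split => -[x y] /=.
- move=> [Xx [Xy [i [j [iltn [jltn xy]]]]]]; split=> // /eqP.
  rewrite psumr_eq0 => [/allP|a _]; last exact: hit_ge0.
  move=> /(_ (Ordinal iltn, Ordinal jltn)); rewrite mem_index_enum => /(_ isT).
  by rewrite /hit /close /= !iter_extend_id// xy oner_eq0.
- move=> [[Xx Xy] /eqP]; rewrite psumr_eq0 => [/allPn[a _]|a _]; last exact: hit_ge0.
  rewrite /hit /close /= !iter_extend_id//; case: ltP; last by rewrite eqxx.
  by move=> xy _; split=> //; split=> //; exists a.1, a.2; rewrite !ltn_ord.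
Qed.

Lemma measure_setC_null (R : realType) (d : measure_display)
    (T : measurableType d) (P : {measure set T -> \bar R}) (A : set T) :
  P setT = 1%E -> measurable A -> P A = 1%E -> P (~` A) = 0%E.
Proof.
move=> P1 mA PA; have mAC := measurableC mA.
have : (P A + P (~` A) = 1)%E by rewrite -measureU ?setICr// setUv.
by rewrite PA; move=> /(congr1 (fun z => z - 1)%E); rewrite addeAC subee// add0e.
Qed.

(** The complement of [Eset] consists of the points without hits together with the complement of X x
    X, which is null for the product. *)
Lemma measure_Eset_setC_le (R : realType) (X : set R) (T S : R -> R)
    (mu nu : probability R R) (n : nat) (r : R) :
  prob_preserving X T mu -> prob_preserving X S nu ->
  measurable (Eset X T S n r) /\
  ((mu \x nu) (~` Eset X T S n r) <=
   (mu \x nu) [set p | hits (extend_id X T) (extend_id X S) r n p = 0%R])%E.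
Proof.
move=> pT pS; have [mX muX XT _ _] := pT; have [_ nuX XS _ _] := pS.
have [[mT _] [mS _]] := (preserves_extend_id pT, preserves_extend_id pS).
have mZ := measurable_no_hits r n mT mS; rewrite Eset_hits//.
have mXX : measurable (X `*` X) by exact: measurableX.
split; first by apply: measurableI => //; exact: measurableC.
have mXXC : measurable (~` (X `*` X)) by exact: measurableC.
have PXX : ((mu \x nu) (X `*` X) = 1)%E.
  by rewrite product_measure1E// -[RHS]mule1; congr (_ * _)%E.
have PXXC : ((mu \x nu) (~` (X `*` X)) = 0)%E.
  exact: (measure_setC_null (product_prob_setT mu nu)).
rewrite setCI setCK; apply: (le_trans (measureU2 _ _ _)) => //.
by rewrite -[leRHS]add0e; apply: leeD => //; rewrite le_eqVlt; apply/orP; left; apply/eqP.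
Qed.

Theorem mainTheorem4 (R : realType) (X : set R) (T1 T2 : R -> R)
  (mu1 mu2 : probability R R) (r : nat -> R) :
  prob_preserving X T1 mu1 -> prob_preserving X T2 mu2 ->
  exp_mixing_BV_Linf X T1 mu1 -> exp_mixing_BV_Linf X T2 mu2 ->
  (forall n, 0 < r n) ->
  (exists h : nat -> R, (forall n, 0 < h n) /\ h @ \oo --> +oo /\
     \forall n \near \oo,
       ((\int[mu2]_(y in X) mu1 (ball y (r n)))
          >= ((ln n%:R) ^+ 2 * h n / n%:R ^+ 2)%:E)%E /\
       Num.sqrt (fine (\int[mu1]_(y in X) mu1 (ball y (r n))))
         / fine (\int[mu2]_(y in X) mu1 (ball y (r n)))
         <= n%:R / (ln n%:R * h n) /\
       Num.sqrt (fine (\int[mu2]_(y in X) mu2 (ball y (r n))))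
         / fine (\int[mu2]_(y in X) mu1 (ball y (r n)))
         <= n%:R / (ln n%:R * h n)) ->
  ((mu1 \x mu2)%E (limsup_set (fun n => Eset X T1 T2 n (r n))) = 1%E).
Proof.
move=> pT1 pT2 mix1 mix2 r0 [h [_ [hoo hyp]]].
have [mX mu1X _ _ _] := pT1; have [_ mu2X _ _ _] := pT2.
have [K1 [th1 [K10 th10 up1]]] := mixing_upper_bound_extend_id pT1 mix1.
have [K2 [th2 [K20 th20 up2]]] := mixing_upper_bound_extend_id pT2 mix2.
pose K := K1 + K2; pose theta := Num.min th1 th2.
have K0 : 0 <= K by rewrite addr_ge0// ltW.
have th0 : 0 < theta by rewrite lt_min th10.
have {}up1 : mixing_upper_bound (extend_id X T1) mu1 K theta.
  apply: mixing_upper_bound_weaken up1; first exact: ltW.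
    by rewrite lerDl ltW.
  by rewrite ge_min lexx.
have {}up2 : mixing_upper_bound (extend_id X T2) mu2 K theta.
  apply: mixing_upper_bound_weaken up2; first exact: ltW.
    by rewrite lerDr ltW.
  by rewrite ge_min lexx orbT.
have pE1 := preserves_extend_id pT1; have pE2 := preserves_extend_id pT2.
(* Turns the integrals over X in the hypotheses into integrals of real ball masses over the line. *)
have toX (mu nu : probability R R) n : nu X = 1%E ->
    (\int[nu]_(y in X) mu (ball y (r n)) =
     \int[nu]_y (ball_mass mu (r n) y)%:E)%E.
  move=> nuX; under eq_integral do rewrite -ball_mass_EFin.
  apply: integral_full_set => //.
    apply/measurable_EFinP; exact: measurable_unit_bv (unit_bv_ball_mass mu (r0 n)).
  by move=> y; rewrite lee_fin; case/andP: (ball_mass01 mu (r n) y).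
apply: (measure_limsup_set_full (product_prob_setT mu1 mu2)).
  by move=> n; have [] := measure_Eset_setC_le n (r n) pT1 pT2.
move=> e k e0; pose b := 10 / theta + 3.
have b0 : 0 <= b by rewrite addr_ge0// divr_ge0// ltW.
(* The final bound is B / n + D / h n. The thresholds [N1] and [N2] make each summand at most e / 2;
   they also give h n >= 1 and, through n >= [expR 1], ln n >= 1. *)
pose B := 2 * K + 2 * K * b; pose D := 4 * b + b ^+ 2.
have B0 : 0 <= B by rewrite addr_ge0// !mulr_ge0.
have D0 : 0 <= D by rewrite addr_ge0 ?sqr_ge0// mulr_ge0.
have e20 : 0 < e / 2 by rewrite divr_gt0.
have [N0 _ {}hyp] := hyp.
have [N1 _ hlarge] : \forall n \near \oo, Num.max 1 (D / (e / 2)) <= h n.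
  by move/cvgryPge : hoo; exact.
have [N2 _ nlarge] := nbhs_infty_ger (Num.max (expR 1) (B / (e / 2))).
(* Beyond all thresholds at once: [k] for the limsup, [N0] for the hypotheses, [N1] for [h], [N2]
   for n itself. *)
pose n := maxn (maxn k N0) (maxn N1 N2).
have kn : (k <= n)%N by rewrite !leq_max leqnn.
have /hlarge : (N1 <= n)%N by rewrite !leq_max leqnn !orbT.
rewrite /= ge_max => /andP[h1 hD].
have /nlarge : (N2 <= n)%N by rewrite !leq_max leqnn !orbT.
rewrite /= ge_max => /andP[ne nB].
have /hyp : (N0 <= n)%N by rewrite !leq_max leqnn !orbT.
rewrite /= !toX// => -[hM [hA1 hA2]].
have nR : 0 < n%:R :> R by apply: lt_le_trans ne; exact: expR_gt0.
have L1 : 1 <= ln n%:R :> R.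
  by rewrite -[leLHS]expRK ler_ln ?posrE ?expR_gt0.
have fM : (\int[mu2]_y (ball_mass mu1 (r n) y)%:E)%E \is a fin_num.
  apply: integral_unit_fin_num; last exact: ball_mass01.
  exact: measurable_unit_bv (unit_bv_ball_mass mu1 (r0 n)).
exists n => //; have [_ le1] := measure_Eset_setC_le n (r n) pT1 pT2.
apply: (le_trans le1).
rewrite -(fineK fM) lee_fin in hM.
apply: (le_trans (measure_no_hits_small (r0 n) K0 th0 pE1 pE2 up1 up2
  (esym (fineK fM)) L1 h1 hM hA1 hA2 (erefl b))).
have h0 : 0 < h n by exact: lt_le_trans h1.
have e1 : B / n%:R <= e / 2.
  by rewrite ler_pdivrMr// mulrC -ler_pdivrMr.
have e2 : D / h n <= e / 2.
  by rewrite ler_pdivrMr// mulrC -ler_pdivrMr.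
by rewrite lee_fin -/B -/D; lra.
Qed.
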